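(* Let $T_h$ be the complete binary tree of height $h\geq 8$. Then $$\frac{|V(T_h)|}{16}<p(T_h)<\frac{|V(T_h)|}{8},$$ where $p(T_h)$ denotes the optimal-pegging number of $T_h$.
   Context: A distribution $D$ of pegs on a graph $G$ is a subset of $V(G)$ (the vertices holding one peg each). A pegging move from $D$ to $D'$: there are distinct vertices $u,v\in D$ and $w\notin D$ with both $u$ and $w$ adjacent to $v$, and $D'=(D\setminus\{u,v\})\cup\{w\}$. A vertex $x$ is reachable from $D$ if some finite (possibly empty) sequence of pegging moves starting at $D$ yields a distribution containing $x$. The reach $R(D)$ is the set of vertices reachable from $D$; $G$ can be pegged by $D$ if $R(D)=V(G)$. The optimal-pegging number $p(G)$ is the minimum size of a distribution on $G$ that can peg $G$. The complete binary tree $T_h$ of height $h$ is the rooted tree in which every vertex at distance less than $h$ from the root has exactly two children and the leaves are exactly the vertices at distance $h$ from the root. *)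

(* Defs.v *)
From mathcomp Require Import all_boot.

Set Implicit Arguments.
Unset Strict Implicit.
Unset Printing Implicit Defensive.

Section Pegging.

(* A finite graph is given by its adjacency relation, to be instantiated with a
   symmetric and irreflexive one. *)
Variables (V : finType) (adj : rel V).

(* The peg on u jumps over the adjacent peg on v (which is removed) to the
   empty vertex w. *)
Definition peg_move (D D' : {set V}) : bool :=
  [exists u, exists v, exists w,
    [&& u \in D, v \in D, u != v, w \notin D, adj u v, adj w v
      & D' == (D :\: [set u; v]) :|: [set w]]].

Definition reach (D : {set V}) : {set V} :=
  [set x | [exists D' : {set V}, connect peg_move D D' && (x \in D')]].

Definition can_peg (D : {set V}) : bool := reach D == [set: V].

Lemma can_peg_setT : can_peg [set: V].
Proof.
apply/eqP/setP=> x; rewrite !inE; apply/existsP; exists [set: V].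
by rewrite connect0 inE.
Qed.

(* By can_peg_setT the arg min ranges over a nonempty family, so its default
   value is never used as junk. *)
Definition optimal_pegging_number : nat :=
  #|[arg min_(D < [set: V] | can_peg D) #|D|]|.

Lemma optimal_pegging_numberP :
  (exists2 D : {set V}, can_peg D & #|D| = optimal_pegging_number) /\
  (forall D : {set V}, can_peg D -> optimal_pegging_number <= #|D|).
Proof.
rewrite /optimal_pegging_number.
case: arg_minnP => [|D pegD minD]; first exact: can_peg_setT.
by split; first exists D.
Qed.

End Pegging.

(* A vertex of the complete binary tree of height h is the sequence of left and
   right turns on its path from the root; the leaves are the sequences of
   length h. *)
Definition cbtree (h : nat) : finType := h.-bseq bool.

Definition cbtree_child (h : nat) (x y : cbtree h) : bool :=
  [exists b : bool, val y == rcons (val x) b].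

Definition cbtree_adj (h : nat) : rel (cbtree h) :=
  fun x y => cbtree_child x y || cbtree_child y x.

Lemma cbtree_adj_sym (h : nat) : symmetric (@cbtree_adj h).
Proof. by move=> x y; rewrite /cbtree_adj orbC. Qed.

Lemma cbtree_adj_irrefl (h : nat) : irreflexive (@cbtree_adj h).
Proof.
move=> x; rewrite /cbtree_adj orbb; apply/existsP => -[b /eqP /(congr1 size)].
by rewrite size_rcons => /esym /eqP; rewrite eqn_leq ltnn.
Qed.

(* Main.v *)
Require Import Defs.
From mathcomp Require Import all_boot all_order all_algebra.
From mathcomp Require Import ring lra zify realalg.
From Stdlib Require Import (notations) String Ascii.
Import Order.TTheory GRing.Theory Num.Theory.

(** Since #|T_h| = 2 ^ (h + 1) - 1, the theorem says that the optimal pegging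
    number lies between 2 ^ (h - 3) and 2 ^ (h - 2) - 1.

    Upper bound.  The distribution filling all the levels of depth at most
    h - 3 has 2 ^ (h - 2) - 1 pegs and reaches every vertex.  Only the last
    eight generations above a given leaf matter: the subtree rooted eight
    levels above it is a copy of T_8 in which the levels 0 to 5 are full, and
    there an explicit list of 30 moves, [strategy], brings a peg to a leaf,
    leaving its parent and grandparent occupied just before the last move.
    Swapping children along the way to the leaf makes any leaf play the role of
    the one in the list ([reach_below_levels]).

    Lower bound.  Let q = (sqrt 5 - 1) / 2, so that q ^ 2 + q = 1, and give a
    peg at distance d from a target x the weight q ^ d.  No move increases the
    total weight, hence a distribution reaching x has total weight at least 1
    with respect to x ([reach_weight]).  Adding up over all the leaves x, a
    distribution reaching all of them has load at least 2 ^ h, where the load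
    of a peg, [leaf_load h j], only depends on its depth j.  Except near the
    root, the load decreases with the depth, and for h >= 8 the 2 ^ (h - 3) - 1
    vertices of depth at most h - 4 are those of largest load
    ([leaf_load_threshold]).  So a distribution with fewer than 2 ^ (h - 3)
    pegs has at most the load of those levels.  That load is computed exactly
    in [total_load] and is less than 2 ^ h.  As h grows, it is asymptotic to
    2 ^ h, so the proof needs the exact golden ratio and not an
    approximation.  *)

(** * Counting vertices by depth *)

Section Counting.
Local Open Scope ring_scope.

Lemma sum_tuple_cons (M : nmodType) n (F : seq bool -> M) :
  \sum_(t : n.+1.-tuple bool) F t =
  \sum_(b : bool) \sum_(t : n.-tuple bool) F (b :: t).
Proof.
rewrite pair_bigA /=.
rewrite (reindex (fun p : bool * n.-tuple bool => [tuple of p.1 :: p.2])) //=.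
exists (fun t => (thead t, [tuple of behead t])) => [[b t] _|t _] /=.
  by congr pair; apply: val_inj.
by rewrite [RHS]tuple_eta; apply: val_inj.
Qed.

Lemma sum_by_depth (M : nmodType) h (F : nat -> M) :
  \sum_(u : cbtree h) F (size u) = \sum_(n < h.+1) F n *+ 2 ^ n.
Proof.
rewrite (reindex (@tagged_tuple_bseq h bool)) /=; last exact/onW_bij.
transitivity (\sum_(n < h.+1) \sum_(t : n.-tuple bool) F n).
  rewrite sig_big_dep /=; apply: eq_big => [p|p _] //.
  by rewrite size_tuple.
by apply: eq_bigr => n _; rewrite sumr_const card_tuple card_bool.
Qed.

Lemma geometric2 n : (\sum_(i < n) 2 ^ i = 2 ^ n - 1)%N.
Proof. by rewrite subn1 predn_exp mul1n. Qed.

Lemma card_levels h m : (m <= h)%N ->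
  #|[set u : cbtree h | (size u <= m)%N]| = (2 ^ m.+1 - 1)%N.
Proof.
move=> le_mh; rewrite cardsE -sum1_card big_mkcond /=.
rewrite (sum_by_depth _ h (fun n => if (n <= m)%N then 1%N else 0%N)).
rewrite -geometric2 (big_ord_widen h.+1 (fun i => (2 ^ i)%N)) //.
rewrite [RHS]big_mkcond; apply: eq_bigr => i _; rewrite ltnS.
by case: ifP => _; rewrite ?mul0rn ?natn.
Qed.

Lemma card_cbtree h : #|cbtree h| = (2 ^ h.+1 - 1)%N.
Proof.
rewrite -(card_levels _ _ (leqnn h)) cardsE; apply: eq_card => u.
by rewrite !inE; exact/esym/size_bseq.
Qed.

End Counting.

(** * Full levels reach everything three levels below *)

(** Moves are played on lists of words of bounded length, where they can be
    checked by computation; such a word is a vertex given by its path from the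
    root of a subtree. *)
Definition word_adj (u v : seq bool) :=
  [|| u == rcons v false, u == rcons v true,
      v == rcons u false | v == rcons u true].

(** The peg on the first word jumps over the second one to the third one. *)
Definition jump := (seq bool * seq bool * seq bool)%type.

Definition after_jump (c : seq (seq bool)) (j : jump) :=
  let: (u, v, w) := j in w :: [seq z <- c | (z != u) && (z != v)].

Fixpoint legal m (c : seq (seq bool)) (js : seq jump) :=
  if js is (u, v, w) :: js' then
    [&& u \in c, v \in c, u != v, w \notin c, word_adj u v, word_adj w v,
        size w <= m & legal m (after_jump c (u, v, w)) js']
  else true.

Definition play := foldl after_jump.

(** A computation on lists of words takes place in any graph containing an
    embedded copy of the words of length at most m.  The pegs outside of the
    copy are left alone, so the set of pegs only has to agree with the list on
    the copy. *)
Lemma replay (V : finType) (e : rel V) (m : nat) (f : seq bool -> V) :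
    (forall t t', size t <= m -> size t' <= m -> f t = f t' -> t = t') ->
    (forall t t', size t <= m -> size t' <= m ->
       word_adj t t' -> e (f t) (f t')) ->
  forall js c (D : {set V}),
    all (fun t => size t <= m) c ->
    (forall t, size t <= m -> (f t \in D) = (t \in c)) -> legal m c js ->
  exists2 D', connect (peg_move e) D D' &
    forall t, size t <= m -> (f t \in D') = (t \in play c js).
Proof.
move=> f_inj f_adj; elim=> [|[[u v] w] js IH] c D short Dc /=.
  by move=> _; exists D.
case/and5P=> uc vc uv wc /and4P[auv awv sw legal_js].
have su := allP short u uc; have sv := allP short v vc.
have feq t t' : size t <= m -> size t' <= m -> (f t == f t') = (t == t').
  by move=> st st'; apply/eqP/eqP => [/f_inj-> //|->].
pose D1 := (D :\: [set f u; f v]) :|: [set f w].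
have move1 : peg_move e D D1.
  apply/existsP; exists (f u); apply/existsP; exists (f v).
  apply/existsP; exists (f w).
  by rewrite !Dc // uc vc feq // uv wc !f_adj // eqxx.
have [||//|D' D1D' D'c] := IH (after_jump c (u, v, w)) D1.
- rewrite /= sw; apply/allP=> z.
  by rewrite mem_filter => /andP[_ /(allP short)].
- move=> t st; rewrite !inE !feq // Dc // mem_filter negb_or orbC.
  by congr (_ || _); rewrite -andbA.
by exists D' => //; exact: connect_trans (connect1 move1) D1D'.
Qed.

Fixpoint words n : seq (seq bool) :=
  if n is n'.+1 then
    [::] :: [seq false :: t | t <- words n'] ++ [seq true :: t | t <- words n']
  else [:: [::]].

Lemma mem_words n t : (t \in words n) = (size t <= n).
Proof.
elim: n t => [|n IH] [|b t] //; rewrite /= inE /= mem_cat ltnS -IH.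
have consI : injective (cons b) by move=> ? ? [].
by case: b consI => consI; rewrite (mem_map consI) ?orbF;
   [rewrite orbC|]; case: (t \in _) => //=; apply/negbTE/mapP => -[].
Qed.

(** A string of 0s and 1s stands for the path turning right at each 1. *)
Definition word (s : String.string) : seq bool :=
  [seq Ascii.eqb a "1"%char | a <- String.list_ascii_of_string s].

Local Open Scope string_scope.

(** Write a_i for the word of i zeros; a_8 is the target, and a_0, ..., a_5
    start with a peg.  Counting backwards from the target, a_6 has to be
    occupied twice, a_5 three times, a_4 and a_3 four times, a_2 five times, a_1
    four times and a_0 three times, either to jump from or to be jumped over.
    The subtrees hanging off this path, rooted at 1, 01, 001, 0001 and 00001,
    provide a peg at their root three, three, two, one and one times, by filling
    it again from their own lower levels.  The list is an order in which these
    30 jumps can be made: one for each time that a word has to be occupied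
    beyond its initial peg. *)
Definition strategy : seq jump :=
  [seq (word p.1.1, word p.1.2, word p.2) | p <- [::
    ("0000", "00000", "000000"); ("00", "000", "0000");
    ("00001", "0000", "00000"); ("00000", "000000", "0000000");
    ("00010", "0001", "000"); ("0010", "001", "00");
    ("00", "000", "0000"); ("00110", "0011", "001");
    ("01", "0", "00"); ("001", "00", "000");
    ("000", "0000", "00000"); ("1", "", "0");
    ("0100", "010", "01"); ("01010", "0101", "010");
    ("100", "10", "1"); ("11", "1", "");
    ("", "0", "00"); ("010", "01", "0");
    ("0", "00", "000"); ("0110", "011", "01");
    ("01110", "0111", "011"); ("011", "01", "0");
    ("1010", "101", "10"); ("1110", "111", "11");
    ("110", "11", "1"); ("10", "1", "");
    ("", "0", "00"); ("00", "000", "0000");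
    ("0000", "00000", "000000"); ("000000", "0000000", "00000000")]].

Local Close Scope string_scope.

(** The last jump goes from a_6 over a_7 to a_8, so stopping before it shows
    that a_6 and a_7 are reached. *)
Lemma strategy_reaches i : 5 < i <= 8 ->
  exists2 js, legal 8 (words 5) js & nseq i false \in play (words 5) js.
Proof.
move=> i_range; exists (take (29 + (i == 8)) strategy).
  by case: (i == 8); vm_compute.
suff : i \in [:: 6; 7; 8] by rewrite !inE => /or3P[]/eqP->; vm_compute.
by rewrite !inE; lia.
Qed.

(** Child swaps along the path s: an automorphism of the binary tree, exchanging
    s with the leftmost path. *)
Definition flip (s t : seq bool) := [seq p.1 (+) p.2 | p <- zip s t].

Lemma size_flip s t : size t <= size s -> size (flip s t) = size t.
Proof. by move=> st; rewrite size_map size2_zip. Qed.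

Lemma flipK s t : size t <= size s -> flip s (flip s t) = t.
Proof.
elim: s t => [|a s IH] [|b t] //= st; congr (_ :: _); first exact: addKb.
exact: IH.
Qed.

Lemma flip_rcons s t b : size t < size s ->
  exists b', flip s (rcons t b) = rcons (flip s t) b'.
Proof.
elim: s t => [|a s IH] [|c t] //= st.
  by exists (a (+) b); case: s {IH st}.
by have [b' Eb'] := IH t st; exists b'; rewrite -Eb'.
Qed.

Lemma flip_nseq s i : i <= size s -> flip s (nseq i false) = take i s.
Proof.
elim: s i => [|a s IH] [|i] //= si; congr (_ :: _); first exact: addbF.
exact: IH.
Qed.

(** The copy of T_8 is rooted at the ancestor p of x, eight levels above it, and
    twisted by flip so that x corresponds to the leaf that the strategy
    reaches. *)
Lemma reach_below_levels g (x : cbtree (g + 8)) i :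
  size x = g + 8 -> 5 < i <= 8 ->
  forall y : cbtree (g + 8), val y = take (g + i) x ->
  y \in reach (@cbtree_adj (g + 8)) [set u : cbtree (g + 8) | size u <= g + 5].
Proof.
move=> size_x i_range y y_prefix.
have [js legal_js i_js] := strategy_reaches i i_range.
pose p := take g x; pose s := drop g x.
have size_p : size p = g by rewrite size_takel // size_x leq_addr.
have size_s : size s = 8 by rewrite size_drop size_x addKn.
pose f t : cbtree (g + 8) := insubd x (p ++ flip s t).
have val_f t : size t <= 8 -> val (f t) = p ++ flip s t.
  move=> st; rewrite insubdK // unfold_in /=.
  by rewrite size_cat size_p size_flip ?size_s // leq_add2l.
have f_inj t t' : size t <= 8 -> size t' <= 8 -> f t = f t' -> t = t'.
  move=> st st' /(congr1 val); rewrite !val_f // => /eqP.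
  rewrite eqseq_cat // => /andP[_ /eqP eq_tt'].
  by rewrite -(flipK s t) ?size_s // eq_tt' flipK ?size_s.
have f_child t b : size (rcons t b) <= 8 -> cbtree_child (f t) (f (rcons t b)).
  rewrite size_rcons => st.
  have [|b' Eb'] := flip_rcons s t b; first by rewrite size_s.
  apply/existsP; exists b'.
  rewrite (val_f t) 1?ltnW // (val_f (rcons t b)) ?size_rcons //.
  by rewrite Eb' -rcons_cat.
have f_adj t t' : size t <= 8 -> size t' <= 8 -> word_adj t t' ->
    cbtree_adj (f t) (f t').
  move=> st st' adj; rewrite /cbtree_adj.
  by case/or4P: adj st st' => /eqP-> ? ?; rewrite f_child ?orbT.
have init t : size t <= 8 ->
    (f t \in [set u : cbtree (g + 8) | size u <= g + 5]) = (t \in words 5).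
  move=> st; rewrite inE val_f // mem_words size_cat size_p.
  by rewrite size_flip ?size_s // leq_add2l.
have short : all (fun t => size t <= 8) (words 5).
  by apply/allP=> t; rewrite mem_words => /leq_trans->.
have [D' DD' D'_js] := replay _ _ 8 f f_inj f_adj js _ _ short init legal_js.
rewrite inE; apply/existsP; exists D'; rewrite DD' /=.
have -> : y = f (nseq i false).
  apply: val_inj; rewrite val_f ?size_nseq; last by case/andP: i_range.
  rewrite flip_nseq ?size_s; last by case/andP: i_range.
  by rewrite y_prefix takeD.
by rewrite D'_js ?size_nseq //; case/andP: i_range.
Qed.

Theorem levels_can_peg g :
  can_peg (@cbtree_adj (g + 8)) [set u : cbtree (g + 8) | size u <= g + 5].
Proof.
apply/eqP/setP=> y; rewrite in_setT.
have size_y : size y <= g + 8 by exact: size_bseq.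
case: (leqP (size y) (g + 5)) => [high|low].
  rewrite inE; apply/existsP; exists [set u : cbtree (g + 8) | size u <= g + 5].
  by rewrite connect0 inE.
(* Any leaf below y will do. *)
have size_x : size (y ++ nseq (g + 8 - size y) false) <= g + 8.
  by rewrite size_cat size_nseq subnKC.
apply: (reach_below_levels g (Bseq size_x) (size y - g)) => /=.
- by rewrite size_cat size_nseq subnKC.
- by rewrite ltn_subRL low leq_subLR size_y.
by rewrite subnKC ?take_size_cat // (leq_trans _ (ltnW low)) ?leq_addr.
Qed.

(** * Weights by powers of the golden ratio *)

(** The graph distance: the two paths to the root are added up from the point
    where they separate. *)
Fixpoint tree_dist (x u : seq bool) : nat :=
  if x is a :: x' then
    if u is b :: u' then
      if a == b then tree_dist x' u' else (size x + size u)%N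
    else size x
  else size u.

Lemma tree_dist0 x : tree_dist x [::] = size x.
Proof. by case: x. Qed.

Lemma tree_distxx x : tree_dist x x = 0%N.
Proof. by elim: x => //= a x ->; rewrite eqxx. Qed.

Lemma tree_dist_rcons x v b :
  (tree_dist x (rcons v b) <= (tree_dist x v).+1)%N /\
  (tree_dist x v <= (tree_dist x (rcons v b)).+1)%N.
Proof.
elim: v x => [|c v IH] [|a x] //=; rewrite ?size_rcons; try by split; lia.
  by case: ifP => _; rewrite ?tree_dist0; split=> /=; lia.
by case: ifP => _; rewrite ?size_rcons; [exact: IH | split; lia].
Qed.

Lemma tree_dist_adj h x (u v : cbtree h) :
  cbtree_adj u v -> (tree_dist x u <= (tree_dist x v).+1)%N.
Proof.
case/orP => /existsP[b /eqP /= ->].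
  by have [] := tree_dist_rcons x u b.
by have [] := tree_dist_rcons x v b.
Qed.

Local Open Scope ring_scope.

Section GoldenWeights.

Variables (R : realFieldType) (q : R).
Hypotheses (q_gt0 : 0 < q) (q_sq : q ^+ 2 = 1 - q).

(** Quotients of Fibonacci numbers, just precise enough for the signs of the
    polynomials in q met below. *)
Lemma q_bounds : 8 / 13 < q < 5 / 8.
Proof. by apply/andP; split; have := q_sq; have := q_gt0; nra. Qed.

Lemma q_le1 : q <= 1.
Proof. by have /andP[] := q_bounds; lra. Qed.

Lemma golden_split n : q ^+ n = q ^+ n.+1 + q ^+ n.+2.
Proof.
have -> : q ^+ n.+2 = q ^+ n * q ^+ 2 by rewrite -exprD addn2.
by rewrite q_sq exprS; ring.
Qed.

(** Adjacent vertices differ by at most one in distance to x.  So a jump either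
    lands no closer to x than the peg jumped over, which already pays for it,
    or moves one step closer at distance d while the two removed pegs, at
    distances d + 1 and at most d + 2, weigh at least q ^ d together. *)
Lemma weight_peg_move h (x : seq bool) (D D' : {set cbtree h}) :
  peg_move (@cbtree_adj h) D D' ->
  \sum_(u in D') q ^+ tree_dist x u <= \sum_(u in D) q ^+ tree_dist x u.
Proof.
case/existsP => u /existsP[v /existsP[w /and5P[uD vD uv wD]]].
case/and3P => auv awv /eqP ->.
rewrite (big_setD1 u uD) (big_setD1 v) /=; last by rewrite !inE vD eq_sym uv.
rewrite (big_setD1 w) /=; last by rewrite !inE eqxx orbT.
have -> : (D :\: [set u; v] :|: [set w]) :\ w = D :\ u :\ v.
  apply/setP=> z; rewrite !inE; case: (eqVneq z w) => [->|_] /=.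
    by rewrite (negbTE wD) !andbF.
  by rewrite orbF negb_or; case: (z == u); case: (z == v).
rewrite addrA; apply: lerD => //.
have duv := tree_dist_adj _ x _ _ auv; have dwv := tree_dist_adj _ x _ _ awv.
have dvw : (tree_dist x v <= (tree_dist x w).+1)%N.
  by apply: tree_dist_adj; rewrite cbtree_adj_sym.
have q1 := q_le1.
have anti (m n : nat) : (m <= n)%N -> q ^+ n <= q ^+ m.
  by move=> ?; apply: ler_wiXn2l => //; apply: ltW.
case: (leqP (tree_dist x v) (tree_dist x w)) => [le_vw|lt_wv].
  by apply: (le_trans (anti _ _ le_vw)); rewrite lerDr exprn_ge0 // ltW.
have dv : tree_dist x v = (tree_dist x w).+1 by lia.
rewrite dv [leLHS]golden_split addrC.
by apply: lerD => //; apply: anti; rewrite -dv.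
Qed.

Lemma reach_weight h (D : {set cbtree h}) (x : cbtree h) :
  x \in reach (@cbtree_adj h) D -> 1 <= \sum_(u in D) q ^+ tree_dist x u.
Proof.
rewrite inE => /existsP[D' /andP[/connectP[p pD ->] {D'}]].
elim: p D pD => [|D' p IH] D /= => [_ xD|/andP[DD' pD'] xD].
  rewrite (big_setD1 x xD) /= tree_distxx lerDl sumr_ge0 // => u _.
  by rewrite exprn_ge0 // ltW.
exact: le_trans (IH _ pD' xD) (weight_peg_move _ x _ _ DD').
Qed.

(** The total weight that a peg at depth j contributes to the 2 ^ h leaves.
    Below the root, half of the leaves lie in the same half of the tree as the
    peg, and the other half are all at distance h + j from it.  At h = 0 the
    value is the one of the formula for tree_dist on any word of length j, so
    that [leaf_load_sum] holds for all words. *)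
Fixpoint leaf_load h j {struct j} : R :=
  if j is j'.+1 then
    if h is h'.+1 then leaf_load h' j' + 2 ^+ h' * q ^+ (h + j) else q ^+ j
  else 2 ^+ h * q ^+ h.

Lemma leaf_load_sum h (u : seq bool) :
  \sum_(x : h.-tuple bool) q ^+ tree_dist x u = leaf_load h (size u).
Proof.
elim: h u => [|h IH] [|b u] /=.
- rewrite (big_pred1 [tuple]) ?mulr1 // => t.
  by rewrite [t]tuple0; apply/esym/eqP.
- rewrite (big_pred1 [tuple]) // => t.
  by rewrite [t]tuple0; apply/esym/eqP.
- rewrite (eq_bigr (fun=> q ^+ h.+1)) => [|x _].
    by rewrite sumr_const card_tuple card_bool -[LHS]mulr_natl natrX.
  by rewrite tree_dist0 size_tuple.
have far : \sum_(x : h.-tuple bool) q ^+ ((size x).+1 + (size u).+1) =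
           2 ^+ h * q ^+ (h.+1 + (size u).+1).
  rewrite (eq_bigr (fun=> q ^+ (h.+1 + (size u).+1))) => [|x _].
    by rewrite sumr_const card_tuple card_bool -[LHS]mulr_natl natrX.
  by rewrite size_tuple.
rewrite (sum_tuple_cons _ h (fun x => q ^+ tree_dist x (b :: u))) big_bool.
by case: b; rewrite /= IH far // addrC.
Qed.

Lemma leaf_load_ge0 h j : 0 <= leaf_load h j.
Proof.
by rewrite -(size_nseq j false) -leaf_load_sum sumr_ge0 // => x _;
   rewrite exprn_ge0 // ltW.
Qed.

Lemma golden_cube : q ^+ 3 = 2 * q - 1.
Proof. by have := golden_split 1; rewrite expr1 q_sq; lra. Qed.

Lemma golden_fourth : q ^+ 4 = 2 - 3 * q.
Proof. by rewrite (exprM q 2 2) q_sq sqrrB q_sq; ring. Qed.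

(** The weights across the root decrease with the depth of the peg, and the rest
    is the same inequality one level down; this reduces to depths 1 and 2. *)
Lemma leaf_load_step h j :
  (j.+2 <= h)%N -> leaf_load h j.+2 <= leaf_load h j.+1.
Proof.
elim: j h => [|j IH] [|h] // lt_jh; last first.
  rewrite [leLHS]/= [leRHS]/= lerD ?IH // ler_wpM2l ?exprn_ge0 //.
  by apply: ler_wiXn2l; rewrite ?q_le1 ?ltW //; lia.
case: h lt_jh => // g _ /=; rewrite -subr_ge0.
rewrite (_ : _ - _ = 2 ^+ g * q ^+ g *
    (2 * q + 2 * q ^+ 3 - 1 - q ^+ 2 - 2 * q ^+ 4)).
  rewrite golden_fourth golden_cube q_sq mulr_ge0 ?mulr_ge0 ?exprn_ge0 ?ltW //.
  by have /andP[] := q_bounds; lra.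
by rewrite !(addSn, addnS, addn0, exprS); ring.
Qed.

(** The root carries less load than depths 1 to 3, as it has no leaf close to
    it, but depth 4 already carries less than the root. *)
Lemma leaf_load_root g : leaf_load g.+4 4 <= leaf_load g.+4 0.
Proof.
rewrite /= -subr_ge0.
rewrite (_ : _ - _ = 2 ^+ g * q ^+ g *
    (16 * q ^+ 4 - 1 - q ^+ 2 - 2 * q ^+ 4 -
     4 * q ^+ 4 * q ^+ 2 - 8 * q ^+ 4 * q ^+ 4)).
  rewrite golden_fourth q_sq mulr_ge0 ?mulr_ge0 ?exprn_ge0 ?ltW //.
  by have := q_sq; have /andP[] := q_bounds; nra.
by rewrite !(addSn, addnS, addn0, exprS); ring.
Qed.

Lemma leaf_load_antitone h i j :
  (0 < i <= j)%N -> (j <= h)%N -> leaf_load h j <= leaf_load h i.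
Proof.
case: i => // i; elim: j => [|j IH] //.
move=> /andP[_]; rewrite leq_eqVlt => /orP[/eqP[->] //|lt_ij] le_jh.
apply: le_trans (IH _ _); [|by []|exact: ltnW].
by case: j lt_ij le_jh {IH} => // j _; exact: leaf_load_step.
Qed.

(** For h = k + 4, the levels of depth at most k are those of largest load.
    The root belongs to them because k + 1 is at least 4. *)
Lemma leaf_load_threshold k i : (4 <= k)%N ->
  ((i <= k)%N -> leaf_load (k + 4) k.+1 <= leaf_load (k + 4) i) /\
  ((k < i <= k + 4)%N -> leaf_load (k + 4) i <= leaf_load (k + 4) k.+1).
Proof.
move=> le4k; split=> [le_ik|/andP[lt_ki le_i]]; last first.
  by apply: leaf_load_antitone.
case: i le_ik => [_|i le_ik]; last by apply: leaf_load_antitone; lia.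
apply: (@le_trans _ _ (leaf_load (k + 4) 4)).
  by apply: leaf_load_antitone; lia.
by rewrite addn4; exact: leaf_load_root.
Qed.

(** The factor (1 + q) ^ 3 is 1 / (2 q - 1), since q ^ 3 = 2 q - 1 and
    1 + q = 1 / q. *)
Lemma geometric_2q k :
  \sum_(n < k.+1) (2 * q) ^+ n = (1 + q) ^+ 3 * ((2 * q) ^+ k.+1 - 1).
Proof.
have inv : (1 + q) ^+ 3 * (2 * q - 1) = 1.
  by rewrite -golden_cube -exprMn mulrDl mul1r -expr2 q_sq addrC subrK expr1n.
by rewrite subrX1 mulrA inv mul1r.
Qed.

(** Removing the root relates k + 1 to k: the total is the load of the root,
    twice the total for the smaller tree, and the weights across the root, which
    form a geometric sum in 2 q. *)
Lemma total_load k :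
  \sum_(n < k.+1) leaf_load (k + 4) n *+ 2 ^ n =
  2 ^+ (k + 4) * (1 - 2 ^+ k.+1 * q ^+ (2 * k).+1 + q ^+ k.+2).
Proof.
elim: k => [|k IH].
  rewrite big_ord1 mulr1n add0n /= golden_fourth !expr1 q_sq; have := q_sq; lra.
rewrite big_ord_recl.
rewrite (eq_bigr (fun n : 'I_k.+1 => 2 * (leaf_load (k + 4) n *+ 2 ^ n) +
    2 ^+ (k + 5) * q ^+ (k + 6) * (2 * q) ^+ n)) => [|n _]; last first.
  rewrite lift0 addSn /= -[LHS]mulr_natr -[leaf_load _ _ *+ _]mulr_natr !natrX.
  rewrite (_ : (k + 4).+1 + n.+1 = k + 6 + n)%N; last by lia.
  rewrite exprMn [q ^+ (k + 6 + n)]exprD [2 ^+ n.+1]exprS.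
  rewrite [2 ^+ (k + 4)]exprD [2 ^+ (k + 5)]exprD.
  by ring.
rewrite big_split /= -!mulr_sumr IH geometric_2q.
rewrite -[2 ^+ (k + 5) * _ * _]mulrA.
have q_inv : q * (1 + q) = 1 by rewrite mulrDr -expr2 q_sq; ring.
have -> : q ^+ (k + 6) * ((1 + q) ^+ 3 * ((2 * q) ^+ k.+1 - 1)) =
          q ^+ k.+3 * ((2 * q) ^+ k.+1 - 1).
  rewrite mulrA; congr (_ * _); rewrite (_ : k + 6 = k.+3 + 3)%N; last lia.
  by rewrite exprD -mulrA -exprMn q_inv expr1n mulr1.
apply/eqP; rewrite -subr_eq0; apply/eqP.
(* Both brackets vanish because q ^ 3 = 2 q - 1 and q ^ 2 = 1 - q. *)
transitivity (32 * 2 ^+ k * (q ^+ k * q ^+ 2 * (q ^+ 3 + 1 - 2 * q) +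
    2 * 2 ^+ k * q ^+ k * q ^+ k * q * (q ^+ 3 + 2 * q ^+ 2 - 1))).
  rewrite exprMn mulnS mul2n -addnn !(addSn, addnS, addn0, exprS, exprD).
  by ring.
by rewrite golden_cube q_sq; ring.
Qed.

Lemma total_load_lt k :
  \sum_(n < k.+1) leaf_load (k + 4) n *+ 2 ^ n < 2 ^+ (k + 4).
Proof.
rewrite total_load gtr_pMr ?exprn_gt0 // -addrA gtrDl addrC subr_lt0.
have /andP[qlo qhi] := q_bounds.
have Qgt0 : 0 < q ^+ k by rewrite exprn_gt0.
have Pge : 1 <= (2 * q) ^+ k by rewrite exprn_ege1 //; lra.
have -> : 2 ^+ k.+1 * q ^+ (2 * k).+1 = 2 * q * q ^+ k * (2 * q) ^+ k.
  by rewrite exprMn mul2n -addnn !exprS exprD; ring.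
apply: lt_le_trans (_ : 2 * q * q ^+ k * 1 <= _); last first.
  by rewrite ler_wpM2l // !mulr_ge0 // ltW.
rewrite !exprS mulr1 -[X in _ < X]mulrA mulrA.
rewrite [ltRHS]mulrA ltr_pM2r // ; nra.
Qed.

(** The excess of the load over the threshold tau is nonnegative at depths up
    to k and nonpositive below, so its sum over D is at most its sum over those
    k + 1 levels.  If D had fewer pegs than they have vertices, its load would
    be at most theirs, which is less than the 2 ^ h needed. *)
Theorem card_pegging_lower h k (D : {set cbtree h}) :
  h = (k + 4)%N -> (4 <= k)%N ->
  can_peg (@cbtree_adj h) D -> (2 ^ k.+1 <= #|D|)%N.
Proof.
move=> h_eq; subst h => le4k /eqP pegD; rewrite leqNgt; apply/negP => ltD.
set tau : R := leaf_load (k + 4) k.+1.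
have need : 2 ^+ (k + 4) <= \sum_(u in D) leaf_load (k + 4) (size u).
  rewrite (eq_bigr (fun u : cbtree (k + 4) =>
      \sum_(x : (k + 4).-tuple bool) q ^+ tree_dist x u)) => [|u _]; last first.
    by rewrite leaf_load_sum.
  rewrite exchange_big /=.
  have -> : 2 ^+ (k + 4) = \sum_(x : (k + 4).-tuple bool) (1 : R).
    by rewrite sumr_const card_tuple card_bool natrX.
  apply: ler_sum => x _.
  have := @reach_weight _ D (bseq_of_tuple x); rewrite pegD.
  by apply; exact: in_setT.
have swap : \sum_(u in D) (leaf_load (k + 4) (size u) - tau) <=
    \sum_(u : cbtree (k + 4) | (size u <= k)%N)
      (leaf_load (k + 4) (size u) - tau).
  rewrite big_mkcond [leRHS]big_mkcond /=; apply: ler_sum => u _.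
  have [top low] := leaf_load_threshold k (size u) le4k.
  have size_u : (size u <= k + 4)%N by exact: size_bseq.
  case: leqP => [/top|lt_ku]; case: ifP => _ //; rewrite ?subr_ge0 //.
  by rewrite subr_le0 low ?lt_ku.
have levels : \sum_(u : cbtree (k + 4) | (size u <= k)%N)
      (leaf_load (k + 4) (size u) - tau) =
    \sum_(n < k.+1) (leaf_load (k + 4) n *+ 2 ^ n) - tau *+ (2 ^ k.+1 - 1).
  rewrite sumrB; congr (_ - _); last first.
    by rewrite sumr_const -(card_levels (k + 4) k (leq_addr _ _)) cardsE.
  rewrite big_mkcond (sum_by_depth _ (k + 4)
    (fun n => if (n <= k)%N then leaf_load (k + 4) n else 0)) /=.
  rewrite (big_ord_widen (k + 4).+1 (fun n => leaf_load (k + 4) n *+ 2 ^ n));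
    last by lia.
  rewrite [RHS]big_mkcond; apply: eq_bigr => n _.
  by rewrite ltnS; case: ifP; rewrite ?mul0rn.
have := total_load_lt k; apply/negP; rewrite -leNgt.
move: swap; rewrite levels sumrB sumr_const.
have : tau *+ #|D| <= tau *+ (2 ^ k.+1 - 1).
  by rewrite ler_wpMn2l ?leaf_load_ge0 //; lia.
move: need; lra.
Qed.

End GoldenWeights.

(** * Bounds on the optimal pegging number *)

Theorem theorem4p7 (h : nat) (hh : (8 <= h)%N) :
  (#|cbtree h|%:R / 16%:R : rat)
    < (optimal_pegging_number (@cbtree_adj h))%:R
    < (#|cbtree h|%:R / 8%:R : rat).
Proof.
have [[D pegD cardD] optimal] := optimal_pegging_numberP (@cbtree_adj h).
have lower : (2 ^ (h - 3) <= optimal_pegging_number (@cbtree_adj h))%N.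
  have sqrt5 : (Num.sqrt 5 : realalg) ^+ 2 = 5 by rewrite sqr_sqrtr.
  have sqrt5_ge0 : 0 <= (Num.sqrt 5 : realalg) by exact: sqrtr_ge0.
  pose q : realalg := (Num.sqrt 5 - 1) / 2.
  have q_gt0 : 0 < q by rewrite /q; nra.
  have q_sq : q ^+ 2 = 1 - q by rewrite /q; nra.
  rewrite -cardD (_ : h - 3 = (h - 4).+1)%N; last by lia.
  by apply: (card_pegging_lower _ q q_gt0 q_sq); [lia | lia | exact: pegD].
have upper : (optimal_pegging_number (@cbtree_adj h) <= 2 ^ (h - 2) - 1)%N.
  have peg_levels :
      can_peg (@cbtree_adj h) [set u : cbtree h | (size u <= h - 3)%N].
    have := levels_can_peg (h - 8).
    by rewrite subnK // (_ : h - 8 + 5 = h - 3)%N //; lia.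
  apply: leq_trans (optimal _ peg_levels) _.
  rewrite card_levels; last exact: leq_subr.
  by rewrite (_ : (h - 3).+1 = h - 2)%N //; lia.
have cardV : (#|cbtree h| + 1 = 2 ^ (h - 3) * 16)%N.
  rewrite card_cbtree subnK ?expn_gt0 // -(expnD 2 _ 4).
  by congr (2 ^ _)%N; lia.
have powS : (2 ^ (h - 2) = 2 ^ (h - 3) * 2)%N.
  by rewrite -expnSr; congr (2 ^ _)%N; lia.
have pow_gt0 : (0 < 2 ^ (h - 3))%N by rewrite expn_gt0.
have lowerQ :
    (#|cbtree h| < optimal_pegging_number (@cbtree_adj h) * 16)%N by lia.
have upperQ :
    (optimal_pegging_number (@cbtree_adj h) * 8 < #|cbtree h|)%N by lia.
by rewrite ltr_pdivrMr // ltr_pdivlMr // -!natrM !ltr_nat lowerQ upperQ.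
Qed.
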